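(* Let $t\in\mathbb{R}$, $\eta\in\mathbb{R}$, $\lambda>-1/2$, $b=\lambda+i\eta$, and let $\Phi_n$ be the monic orthogonal polynomials on the unit circle with respect to the weight function $$w(\theta)=e^{t\cos(\theta)}e^{-\eta\theta}[\sin^2(\theta/2)]^{\lambda},\qquad 0\le\theta\le2\pi.$$ Put $\mathfrak{s}_{n,n}=-(\overline b+n)+(t/2)(1+\alpha_n\overline{\alpha}_{n-1})$. Then, for $n\ge1$, $$z^2(z-1)\Phi_n'(z)=U_n(z)\Phi_n(z)+V_n(z)\Phi_n^*(z),$$ $$z(z-1)(\Phi_n^* )'(z)=W_n(z)\Phi_n(z)+Y_n(z)\Phi_n^*(z),$$ where $$U_n(z)=[n-(t/2)\overline{\alpha}_n\alpha_{n-1}]z^2+\mathfrak{s}_{n,n}z-t/2,$$ $$V_n(z)=-(t/2)\overline{\alpha}_nz^2-[(1-\overline{\mathfrak{s}}_{n,n})\overline{\alpha}_n+(t/2)(1-|\alpha_n|^2)\overline{\alpha}_{n+1}]z-(t/2)\overline{\alpha}_{n-1},$$ $$W_n(z)=-(t/2)\alpha_{n-1}z^2-[(1-\mathfrak{s}_{n,n})\alpha_n+(t/2)(1-|\alpha_n|^2)\alpha_{n+1}]z-(t/2)\alpha_n,$$ $$Y_n(z)=-\{(t/2)z^2-(\overline{\mathfrak{s}}_{n,n}+n)z+(t/2)\alpha_n\overline{\alpha}_{n-1}\}.$$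
   Context: The monic orthogonal polynomials $\Phi_n$ ($\deg\Phi_n=n$) are orthogonal for $\langle f,g\rangle=\int_0^{2\pi}f(e^{i\theta})\overline{g(e^{i\theta})}\,w(\theta)\,d\theta$. Reversed polynomial: $\Phi_n^*(z)=z^n\overline{\Phi_n(1/\overline z)}$. Verblunsky coefficients: $\alpha_{n-1}=-\overline{\Phi_n(0)}$ for $n\ge1$, and $\alpha_{-1}=-1$. Prime denotes $d/dz$. *)

(* Defs.v *)
From HB Require Import structures.
From mathcomp Require Import all_boot all_order all_algebra.
From mathcomp Require Import all_classical all_reals all_analysis.
From mathcomp Require Export complex.

Set Implicit Arguments.
Unset Strict Implicit.
Unset Printing Implicit Defensive.

Import Order.TTheory GRing.Theory Num.Theory.

Local Open Scope ring_scope.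
Local Open Scope complex_scope.

Section OPUC.
Variable R : realType.
Local Notation C := R[i].

Definition expi (theta : R) : C := cos theta +i* sin theta.

Definition circle_integral (F : R -> C) : C :=
  (\int[lebesgue_measure]_(theta in `[0, 2 * pi]%classic) complex.Re (F theta))%R +i*
  (\int[lebesgue_measure]_(theta in `[0, 2 * pi]%classic) complex.Im (F theta))%R.

Definition opuc_inner (w : R -> R) (f g : C -> C) : C :=
  circle_integral
    (fun theta => f (expi theta) * Num.conj (g (expi theta)) * (w theta)%:C).

Definition monic_opuc (w : R -> R) (Phi : nat -> {poly C}) : Prop :=
  [/\ forall n, size (Phi n) = n.+1,
      forall n, Phi n \is monic
    & forall m n, m != n -> opuc_inner w (horner (Phi m)) (horner (Phi n)) = 0].

(* Phi_n^*(z) = z^n conj(Phi_n(1 / conj z)), extended to z = 0 by reversing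
   and conjugating coefficients; see horner_reversed. *)
Definition reversed (n : nat) (p : {poly C}) : {poly C} :=
  \poly_(i < n.+1) Num.conj p`_(n - i).

Lemma horner_reversed (n : nat) (p : {poly C}) (z : C) :
  (size p <= n.+1)%N -> z != 0 ->
  (reversed n p).[z] = z ^+ n * Num.conj p.[1 / Num.conj z].
Proof.
move=> sp z0; rewrite /reversed horner_poly (horner_coef_wide _ sp).
rewrite rmorph_sum mulr_sumr (reindex_inj rev_ord_inj) /=.
apply: eq_bigr => i _; have le_in : (i <= n)%N by rewrite -ltnS.
rewrite subSS subKn// rmorphM rmorphXn /= mulrCA; congr (_ * _).
rewrite mul1r fmorphV /= (_ : Num.conj (Num.conj z) = z); last exact: conjCK.
have -> : z ^+ n = z ^+ (n - i) * z ^+ i by rewrite -exprD subnK.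
rewrite exprVn -mulrA mulfV ?mulr1//.
exact: expf_neq0.
Qed.

(* alpha_k = - conj(Phi_(k+1)(0)) for k >= 0; the value alpha_(-1) = -1, which
   is the same formula with Phi_0 = 1, is outside this indexing. *)
Definition verblunsky (Phi : nat -> {poly C}) (k : nat) : C :=
  - Num.conj (Phi k.+1).[0].

Definition weight (t eta lambda theta : R) : R :=
  expR (t * cos theta) * expR (- (eta * theta))
  * ((sin (theta / 2)) ^+ 2) `^ lambda.

Section Coefficients.
Variables (t : R) (b : C) (alpha : nat -> C) (n : nat).
Local Notation t2 := ((t / 2)%:C).
Local Notation "x ^*" := (Num.conj x).
Local Notation a := (alpha n).
Local Notation am := (alpha n.-1).
Local Notation ap := (alpha n.+1).

Definition s_nn : C := - (b^* + n%:R) + t2 * (1 + a * am^*).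

Definition U_coef (z : C) : C :=
  (n%:R - t2 * a^* * am) * z ^+ 2 + s_nn * z - t2.

Definition V_coef (z : C) : C :=
  - (t2 * a^*) * z ^+ 2
  - ((1 - s_nn^*) * a^* + t2 * (1 - `|a| ^+ 2) * ap^*) * z
  - t2 * am^*.

Definition W_coef (z : C) : C :=
  - (t2 * am) * z ^+ 2
  - ((1 - s_nn) * a + t2 * (1 - `|a| ^+ 2) * ap) * z
  - t2 * a.

Definition Y_coef (z : C) : C :=
  - (t2 * z ^+ 2 - (s_nn^* + n%:R) * z + t2 * a * am^*).

End Coefficients.
End OPUC.

(* Main.v *)
(* Write z = e^(i theta) and w' = dw/dtheta.  Since the weight satisfies
     (z - 1) w' = i ((t/2)(z - 1)(z - 1/z) + b z + conj b) w
   and (z - 1) w vanishes at both endpoints (this is where lambda > -1/2 enters),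
   integrating the derivative of (z - 1) p(z) conj(z^j) w gives a Pearson-type
   identity for the inner product.  Through it, the difference F of the two sides
   of the first structure relation, a polynomial of degree at most n + 1 with
   F(0) = 0, is seen to be orthogonal to z, ..., z^(n+1), so F = 0.  The only
   further inputs are the orthogonality of Phi_n and Phi_n^* and the Szego
   recurrence.  The second relation is the reversal of the first. *)

Require Import Defs.
From mathcomp Require Import all_boot all_order all_algebra.
From mathcomp Require Import all_classical all_reals all_analysis.
From mathcomp Require Import measurable_realfun complex ring lra.

Import Order.TTheory GRing.Theory Num.Theory.
Import numFieldNormedType.Exports.
Local Open Scope classical_set_scope.
Local Open Scope ring_scope.
Local Open Scope complex_scope.

(** * Reversal of polynomials *)

Section Reversal.
Variable R : realType.
Implicit Types (p q : {poly R[i]}) (n : nat).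

Lemma coef_reversed n p i :
  (reversed n p)`_i = if (i < n.+1)%N then Num.conj p`_(n - i) else 0.
Proof. by rewrite coef_poly. Qed.

Lemma size_reversed n p : (size (reversed n p) <= n.+1)%N.
Proof. exact: size_poly. Qed.

Lemma reversed_mulX n p : reversed n.+1 ('X * p) = reversed n p.
Proof.
apply/polyP => i; rewrite !coef_reversed coefXM.
have [lein|] := ltnP i n.+1; first by rewrite ltnS ltnW // subSn.
rewrite leq_eqVlt => /predU1P[<-|ltni]; last by rewrite ltnNge ltni.
by rewrite ltnSn subnn rmorph0.
Qed.

(** The operator z d/dz multiplies the coefficient of z^i by i, and that coefficient comes from
    index n - i of [p]; the identity is i = n - (n - i), read coefficientwise. *)
Lemma mulX_deriv_reversed n p :
  'X * (reversed n p)^`() = n%:R *: reversed n p - reversed n ('X * p^`()).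
Proof.
apply/polyP => i; rewrite coefXM coefB coefZ !coef_reversed coefXM.
case: i => [|i] /=; last rewrite coef_deriv coef_reversed ltnS.
  rewrite subn0; case: n => [|n] /=; first by rewrite mul0r rmorph0 subr0.
  by rewrite coef_deriv rmorphMn mulr_natl subrr.
have [lin|] := ltnP i n; last by rewrite mul0rn mulr0 subr0.
have [m ->] : exists m, n = (i.+1 + m)%N by exists (n - i.+1)%N; rewrite subnKC.
rewrite addKn; case: m => [|m] /=.
  by rewrite rmorph0 subr0 addn0 mulr_natl.
by rewrite coef_deriv rmorphMn mulr_natl -mulrnBr ?leq_addl // addnK.
Qed.

Lemma reversedD n p q : reversed n (p + q) = reversed n p + reversed n q.
Proof.
apply/polyP => i; rewrite coefD !coef_reversed coefD rmorphD.
by case: ifP; rewrite ?addr0.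
Qed.

Lemma reversedZ n c p : reversed n (c *: p) = Num.conj c *: reversed n p.
Proof.
apply/polyP => i; rewrite coefZ !coef_reversed coefZ rmorphM.
by case: ifP; rewrite ?mulr0.
Qed.

Lemma reversedB n p q : reversed n (p - q) = reversed n p - reversed n q.
Proof. by rewrite reversedD -scaleN1r reversedZ rmorphN1 scaleN1r. Qed.

Lemma reversedS n p : (size p <= n.+1)%N ->
  reversed n.+1 p = 'X * reversed n p.
Proof.
move=> sp; apply/polyP => -[|i]; rewrite coefXM !coef_reversed /=.
  by rewrite nth_default ?rmorph0 // subn0.
by rewrite ltnS subSS.
Qed.

Lemma reversedK n p : (size p <= n.+1)%N -> reversed n (reversed n p) = p.
Proof.
move=> sp; apply/polyP => i; rewrite !coef_reversed.
case: ltnP => [lein|/(leq_trans sp) /(nth_default 0) -> //].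
by rewrite ltnS leq_subr subKn // conjCK.
Qed.

End Reversal.

(** * Definite Hermitian forms with shift invariance and a Pearson identity *)

Section Form.
Variable R : realType.
Local Notation C := R[i].
Implicit Types (p q : {poly C}) (n j : nat).
Local Notation "x ^*" := (Num.conj x).
Variable B : {poly C} -> {poly C} -> C.
Hypothesis B_linear : forall q, linear_for *%R (B^~ q).
Hypothesis B_herm : forall p q, B q p = (B p q)^*.
Hypothesis B_shift : forall p q, B ('X * p) ('X * q) = B p q.
Hypothesis B_definite : forall p, B p p = 0 -> p = 0.
Variables (b t2 : C).
Hypothesis t2_real : t2^* = t2.
(* The last term is <p / z, z^j>, moved to the right to stay within polynomials. *)
Hypothesis B_pearson : forall p j,
  B (('X - 1) * ('X * p^`())) 'X^j =
  j%:R * B (('X - 1) * p) 'X^j - B ('X * p) 'X^j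
  - B (b *: ('X * p) + b^* *: p) 'X^j
  - t2 * (B (('X^2 - 'X - 1) * p) 'X^j + B p 'X^(j.+1)).

Lemma inner0l q : B 0 q = 0.
Proof.
have := B_linear q 1 0 0; rewrite scaler0 addr0 mul1r => B00.
by apply: (addIr (B 0 q)); rewrite add0r -B00.
Qed.

Lemma innerZl c p q : B (c *: p) q = c * B p q.
Proof. by rewrite -[c *: p]addr0 B_linear inner0l addr0. Qed.

Lemma innerDl p1 p2 q : B (p1 + p2) q = B p1 q + B p2 q.
Proof. by rewrite -[p1]scale1r B_linear mul1r scale1r. Qed.

Lemma innerNl p q : B (- p) q = - B p q.
Proof. by rewrite -scaleN1r innerZl mulN1r. Qed.

Lemma innerBl p1 p2 q : B (p1 - p2) q = B p1 q - B p2 q.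
Proof. by rewrite innerDl innerNl. Qed.

Lemma inner_suml I (r : seq I) (F : I -> {poly C}) q :
  B (\sum_(i <- r) F i) q = \sum_(i <- r) B (F i) q.
Proof.
elim: r => [|i r IH]; first by rewrite !big_nil inner0l.
by rewrite !big_cons innerDl IH.
Qed.

Lemma inner0r q : B q 0 = 0.
Proof. by rewrite B_herm inner0l rmorph0. Qed.

Lemma innerDr p q1 q2 : B p (q1 + q2) = B p q1 + B p q2.
Proof. by rewrite B_herm innerDl rmorphD /= -!B_herm. Qed.

Lemma innerZr c p q : B p (c *: q) = c^* * B p q.
Proof. by rewrite B_herm innerZl rmorphM /= -B_herm. Qed.

Lemma inner_sumr I (r : seq I) (F : I -> {poly C}) p :
  B p (\sum_(i <- r) F i) = \sum_(i <- r) B p (F i).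
Proof.
elim: r => [|i r IH]; first by rewrite !big_nil inner0r.
by rewrite !big_cons innerDr IH.
Qed.

Lemma inner_shiftXn p j : B ('X * p) 'X^(j.+1) = B p 'X^j.
Proof. by rewrite exprS B_shift. Qed.

Lemma inner_toeplitz i j k : B 'X^(i + k) 'X^(j + k) = B 'X^i 'X^j.
Proof.
elim: k => [|k IH]; first by rewrite !addn0.
by rewrite !addnS [X in B X]exprS inner_shiftXn IH.
Qed.

(** On the unit circle the reversal is z^n times the conjugate of p. For an abstract form only the
    Toeplitz structure of the moments is available, so [p] is expanded in monomials. *)
Lemma inner_reversed n p j : (size p <= n.+1)%N -> (j <= n)%N ->
  B (reversed n p) 'X^j = (B p 'X^(n - j))^*.
Proof.
move=> sp lejn.
have -> : p = \sum_(i < n.+1) p`_i *: 'X^i.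
  rewrite -poly_def; apply/polyP => i; rewrite coef_poly.
  by case: ltnP => // /(leq_trans sp) /(nth_default 0).
rewrite inner_suml rmorph_sum /= /reversed poly_def inner_suml.
rewrite (reindex_inj rev_ord_inj) /=; apply: eq_bigr => i _.
have lein : (i <= n)%N by rewrite -ltnS.
rewrite subSS subKn // !innerZl rmorphM /= -B_herm -poly_def coef_poly ltn_ord.
(* Both moments are shifted to the common one <z^n, z^(i + j)>. *)
congr (_ * _); rewrite -(inner_toeplitz (n - i) j i) subnK //.
by rewrite -(inner_toeplitz (n - j) i j) subnK // addnC.
Qed.

(** The exponent n + 1 lies one beyond the range of [inner_reversed]; passing to 'X * p, whose
    reversal at degree n + 1 is the same polynomial, brings it back into range. *)
Lemma inner_reversed_top n p : (size p <= n.+1)%N ->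
  B (reversed n p) 'X^(n.+1) = (B ('X * p) 1)^*.
Proof.
move=> sp; rewrite -reversed_mulX inner_reversed ?subnn ?expr0 //.
by rewrite (leq_trans (size_polyMleq _ _)) // size_polyX.
Qed.

Lemma inner_eq0 n p : (size p <= n)%N ->
  (forall j, (j < n)%N -> B p 'X^j = 0) -> p = 0.
Proof.
move=> sp Bp; apply: B_definite.
have {2}-> : p = \sum_(i < n) p`_i *: 'X^i.
  rewrite -poly_def; apply/polyP => i; rewrite coef_poly.
  by case: ltnP => // /(leq_trans sp) /(nth_default 0).
by rewrite inner_sumr big1 // => i _; rewrite innerZr Bp ?mulr0.
Qed.

(** Since z divides [p], shift invariance moves the orthogonality to the quotient, which is then
    orthogonal to every power up to its own degree. This is the uniqueness principle behind both the
    Szego recurrence and the structure relation. *)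
Lemma inner_mulX_eq0 n p : (size p <= n.+1)%N -> p`_0 = 0 ->
  (forall j, (j < n)%N -> B p 'X^(j.+1) = 0) -> p = 0.
Proof.
move=> sp p0 Bp.
have pE : p = 'X * drop_poly 1 p.
  rewrite -{1}(poly_take_drop 1 p) expr1 mulrC.
  rewrite (_ : take_poly 1 p = 0) ?add0r //; apply/polyP => i.
  by rewrite coef_take_poly coef0; case: i.
rewrite pE (_ : drop_poly 1 p = 0) ?mulr0 //.
apply: (inner_eq0 n); first by rewrite size_drop_poly leq_subLR.
by move=> j /Bp; rewrite {1}pE inner_shiftXn.
Qed.

(** * Orthogonal polynomials, Szego recurrence and structure relations *)

Variable Phi : nat -> {poly C}.
Hypothesis size_Phi : forall n, size (Phi n) = n.+1.
Hypothesis monic_Phi : forall n, Phi n \is monic.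
Hypothesis orth_Phi : forall m n, m != n -> B (Phi m) (Phi n) = 0.

Local Notation alpha := (verblunsky Phi).
Local Notation PhiS n := (reversed n (Phi n)).
Local Notation h n := (B (Phi n) 'X^n).

Lemma coef_Phi_top n : (Phi n)`_n = 1.
Proof. by have /monicP := monic_Phi n; rewrite lead_coefE size_Phi. Qed.

Lemma coef_Phi_gt n j : (n < j)%N -> (Phi n)`_j = 0.
Proof. by move=> ltnj; rewrite nth_default ?size_Phi. Qed.

Lemma coef_Phi0 n : (Phi n.+1)`_0 = - (alpha n)^*.
Proof.
by rewrite /verblunsky rmorphN opprK /= horner_coef0 conjCK.
Qed.

Lemma coef_PhiS0 n : (PhiS n)`_0 = 1.
Proof. by rewrite coef_reversed subn0 coef_Phi_top rmorph1. Qed.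

Lemma orth_Phi_lower n k q :
  (k <= n)%N -> (size q <= k)%N -> B (Phi n) q = 0.
Proof.
elim: k q => [|k IH] q lekn sq.
  by move: sq; rewrite leqn0 size_poly_eq0 => /eqP ->; rewrite inner0r.
(* As [Phi k] is monic of degree k, subtracting this multiple removes the top coefficient of [q],
   and the induction hypothesis takes the remainder. *)
have -> : q = (q - q`_k *: Phi k) + q`_k *: Phi k by rewrite subrK.
rewrite innerDr innerZr orth_Phi ?mulr0 ?addr0; last by rewrite gtn_eqF.
apply: (IH _ (ltnW lekn)); apply/leq_sizeP => j lekj.
rewrite coefB coefZ; have [jk|kj] := eqVneq j k.
  by rewrite jk coef_Phi_top mulr1 subrr.
have lkj : (k < j)%N by rewrite ltn_neqAle eq_sym kj.
by rewrite (nth_default _ (leq_trans sq lkj)) coef_Phi_gt // mulr0 subr0.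
Qed.

Lemma orth_Phi_Xn n j : (j < n)%N -> B (Phi n) 'X^j = 0.
Proof. by move=> ljn; rewrite (orth_Phi_lower n n) // size_polyXn. Qed.

Lemma orth_PhiS n j : (0 < j <= n)%N -> B (PhiS n) 'X^j = 0.
Proof.
move=> /andP[j0 ljn]; rewrite inner_reversed ?size_Phi // orth_Phi_Xn ?rmorph0 //.
by rewrite ltn_subrL j0 (leq_trans j0).
Qed.

(** The difference z^n - Phi_n has degree below n, so [h n] is the squared norm <Phi_n, Phi_n>. *)
Lemma inner_Phi_real n : (h n)^* = h n.
Proof.
have -> : h n = B (Phi n) (Phi n); last by rewrite -B_herm.
rewrite -[X in B _ X](subrK (Phi n) 'X^n) innerDr (orth_Phi_lower n n) ?add0r //.
apply/leq_sizeP => j lnj; rewrite coefB coefXn.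
have [->|nj] := eqVneq j n; first by rewrite coef_Phi_top subrr.
by rewrite coef_Phi_gt ?subr0 // ltn_neqAle eq_sym nj.
Qed.

Lemma inner_PhiS0 n : B (PhiS n) 1 = h n.
Proof.
by rewrite -(expr0 'X) inner_reversed ?size_Phi // subn0 inner_Phi_real.
Qed.

(** The difference of the two sides has degree at most n because the leading terms cancel, vanishes
    at 0 by the definition of alpha_n, and is orthogonal to z, ..., z^n. *)
Lemma szego_recurrence n :
  Phi n.+1 = 'X * Phi n - (alpha n)^* *: PhiS n.
Proof.
apply/eqP; rewrite -subr_eq0; apply/eqP; apply: (@inner_mulX_eq0 n).
- apply/leq_sizeP => -[//|j]; rewrite ltnS => lnj.
  rewrite !coefB coefXM coefZ coef_reversed ltnS ltnNge lnj mulr0 subr0 /=.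
  move: lnj; rewrite leq_eqVlt => /predU1P[<-|lnj].
    by rewrite !coef_Phi_top subrr.
  by rewrite !coef_Phi_gt ?subrr.
- by rewrite !coefB coefXM coefZ coef_PhiS0 coef_Phi0 eqxx mulr1; ring.
- move=> j ljn; rewrite !innerBl innerZl inner_shiftXn orth_PhiS //.
  by rewrite !orth_Phi_Xn ?ltnS //; ring.
Qed.

Lemma mulX_Phi n : 'X * Phi n = Phi n.+1 + (alpha n)^* *: PhiS n.
Proof. by rewrite szego_recurrence subrK. Qed.

Lemma inner_mulX_Phi0 n : B ('X * Phi n) 1 = (alpha n)^* * h n.
Proof.
by rewrite mulX_Phi innerDl innerZl inner_PhiS0 -(expr0 'X) orth_Phi_Xn ?add0r.
Qed.

Lemma inner_PhiS_top n : B (PhiS n) 'X^(n.+1) = alpha n * h n.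
Proof.
rewrite inner_reversed_top ?size_Phi // inner_mulX_Phi0 rmorphM /= inner_Phi_real.
by rewrite conjCK.
Qed.

Lemma inner_Phi_succ n : h n.+1 = (1 - `|alpha n| ^+ 2) * h n.
Proof.
rewrite szego_recurrence innerBl innerZl inner_shiftXn inner_PhiS_top normCK.
by ring.
Qed.

(** The powers of z are kept as nested products by 'X so that each shift removes one factor, and the
    derivative occurs only as z Phi_n', the form in which the Pearson identity takes it. *)
Lemma structure_relation n : (0 < n)%N ->
  let a := alpha n in let am := alpha n.-1 in let ap := alpha n.+1 in
  let s := - (b^* + n%:R) + t2 * (1 + a * am^*) in
  'X * ('X * ('X * (Phi n)^`())) - 'X * ('X * (Phi n)^`()) =
    (n%:R - t2 * a^* * am) *: ('X * ('X * Phi n)) + s *: ('X * Phi n)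
    - t2 *: Phi n - (t2 * a^*) *: ('X * ('X * PhiS n))
    - ((1 - s^*) * a^* + t2 * (1 - `|a| ^+ 2) * ap^*) *: ('X * PhiS n)
    - (t2 * am^*) *: PhiS n.
Proof.
move=> n0 a am ap.
(* Positivity of n matters here: [n.-1] then really is n - 1, while alpha_(-1) lies outside the
   indexing. *)
have Phi0 : (Phi n)`_0 = - am^* by rewrite -[n in Phi n](prednK n0) coef_Phi0.
have [aE apE] : alpha n = a /\ alpha n.+1 = ap by [].
clearbody a am ap => s.
have sJ : s^* = - (b + n%:R) + t2 * (1 + a^* * am).
  rewrite /s !(rmorphM, rmorphD, rmorphN) /= t2_real !conjCK rmorph_nat rmorph1.
  by [].
apply/eqP; rewrite -subr_eq0; apply/eqP; apply: (inner_mulX_eq0 n.+1).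
- apply/leq_sizeP => i; rewrite leq_eqVlt => /predU1P[<-|].
    (* Coefficient of z^(n+2): the top coefficient of [PhiS n] is conj Phi_n(0) = -alpha_(n-1), so
       the z^2 term of V_n cancels the t/2 part of the z^2 term of U_n. *)
    rewrite !(coefB, coefD, coefZ, coefXM) /= (gtn_eqF n0) !coef_deriv prednK //.
    rewrite !coef_reversed !ltnS ltnn leqnn ltnNge leqnSn /= subnn Phi0.
    rewrite (coef_Phi_gt n n.+1) // (coef_Phi_gt n n.+2) // coef_Phi_top.
    by rewrite rmorphN /= (conjCK am); ring.
  case: i => [|[|[|i]]] // ltni.
  rewrite !(coefB, coefD, coefZ, coefXM) /= !coef_deriv !coef_reversed.
  rewrite !ltnS in ltni; rewrite !ltnS (leq_gtF ltni) (leq_gtF (leqW ltni)).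
  rewrite (leq_gtF (leqW (leqW ltni))) !coef_Phi_gt ?ltnS ?leqW //.
  by rewrite !mul0rn; ring.
- rewrite !(coefB, coefD, coefZ, coefXM) /= Phi0 coef_PhiS0; ring.
- move=> j; rewrite ltnS => lejn.
  rewrite !(innerBl, innerDl, innerZl, inner_shiftXn).
  have -> : B ('X * ('X * (Phi n)^`())) 'X^j - B ('X * (Phi n)^`()) 'X^j =
     B (('X - 1) * ('X * (Phi n)^`())) 'X^j by rewrite mulrBl mul1r innerBl.
  have X2 : 'X^2 * Phi n = 'X * ('X * Phi n) by rewrite expr2 mulrA.
  rewrite B_pearson !mulrBl !mul1r X2 !(innerBl, innerDl, innerZl).
  (* Orthogonality does not determine <z^2 Phi_n, z^j> directly. The Szego recurrence splits it: the
     part with [Phi n.+1] is the source of alpha_(n+1) in V_n, and the part with [PhiS n] cancels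
     against the z^2 term of V_n. *)
  have -> : B ('X * ('X * Phi n)) 'X^j =
      B ('X * Phi n.+1) 'X^j + a^* * B ('X * PhiS n) 'X^j.
    by rewrite -innerZl -innerDl scalerAr -mulrDr -aE -mulX_Phi.
  rewrite sJ /s; case: j lejn => [_|j ltjn].
    (* Testing against z itself: this case fixes the coefficient of z in V_n. *)
    rewrite expr0 !inner_mulX_Phi0 inner_PhiS0 inner_Phi_succ aE apE.
    have Phi_1 : B (Phi n) 1 = 0 by rewrite -(expr0 'X) orth_Phi_Xn.
    have PhiS_X : B (PhiS n) 'X^1 = 0 by rewrite orth_PhiS.
    by rewrite Phi_1 PhiS_X; ring.
  rewrite !inner_shiftXn (orth_PhiS n j.+1) // (orth_Phi_Xn n j) //.
  rewrite (orth_Phi_Xn n.+1 j) ?leqW //.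
  have [ltjn'|] := ltnP j.+1 n.
    by rewrite (orth_PhiS n j.+2) // (orth_Phi_Xn n j.+1) //; ring.
  (* Testing against z^(n+1): here [h n] survives, and the identity fixes the value of s_(n,n). For
     the powers strictly between, all terms vanish or cancel. *)
  rewrite leq_eqVlt ltnNge ltjn orbF => /eqP <-.
  by rewrite inner_PhiS_top aE; ring.
Qed.

(** Both sides of the first relation have degree at most n + 2, so reversal at that degree exchanges
    [Phi n] with [PhiS n], conjugates the coefficients and reverses the powers of z. *)
Lemma structure_relation_reversed n : (0 < n)%N ->
  let a := alpha n in let am := alpha n.-1 in let ap := alpha n.+1 in
  let s := - (b^* + n%:R) + t2 * (1 + a * am^*) in
  'X * ('X * (PhiS n)^`()) - 'X * (PhiS n)^`() =
    - (n%:R *: PhiS n - n%:R *: ('X * PhiS n))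
    + (n%:R - t2 * a * am^*) *: PhiS n + s^* *: ('X * PhiS n)
    - t2 *: ('X * ('X * PhiS n)) - (t2 * a) *: Phi n
    - ((1 - s) * a + t2 * (1 - `|a| ^+ 2) * ap) *: ('X * Phi n)
    - (t2 * am) *: ('X * ('X * Phi n)).
Proof.
move=> n0; have := structure_relation _ n0.
cbv zeta; rewrite !normCK.
move: (alpha n) (alpha n.-1) (alpha n.+1) => a am ap /(congr1 (reversed n.+2)).
have szX : (size ('X * (Phi n)^`())%R <= n.+1)%N.
  apply/leq_sizeP => -[//|i] ltni.
  by rewrite coefXM coef_deriv coef_Phi_gt ?mul0rn.
have szP : (size (Phi n) <= n.+1)%N by rewrite size_Phi.
have szS := size_reversed _ n (Phi n).
rewrite !(reversedB, reversedD, reversedZ, reversed_mulX).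
(* The preceding rewriting strips one factor 'X too many from this term; it is restored so that only
   the reversal of z Phi_n' occurs. *)
have -> : reversed n (Phi n)^`() = 'X * reversed n ('X * (Phi n)^`()).
  by rewrite -reversedS // reversed_mulX.
have -> : reversed n.+2 (Phi n) = 'X * ('X * PhiS n).
  by rewrite !reversedS // ltnW.
have -> : reversed n.+2 (PhiS n) = 'X * ('X * Phi n).
  by rewrite !reversedS ?reversedK // ltnW.
rewrite (reversedS _ _ _ szP) (reversedS _ _ _ szS) reversedK //.
have -> : reversed n ('X * (Phi n)^`()) = n%:R *: PhiS n - 'X * (PhiS n)^`().
  by rewrite mulX_deriv_reversed subKr.
rewrite !(rmorphM, rmorphD, rmorphB, rmorphN) /= !conjCK rmorph_nat rmorph1.
rewrite t2_real.
move=> /eqP; rewrite -subr_eq0 -!mul_polyC => /eqP eq0.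
apply/eqP; rewrite -subr_eq0; apply/eqP; apply: (etrans _ eq0).
by ring.
Qed.
End Form.

(** * Fundamental theorem of calculus on an open interval *)

Section ImproperFTC.
Variable R : realType.
Implicit Types (F f H h : R -> R) (a b l r : R).
Local Notation mu := (@lebesgue_measure R).

(** The open interval is exhausted by closed ones, on which the usual theorem applies; monotone
    convergence handles the integrals and the one-sided limits of [F] the right-hand sides. *)
Lemma ge0_FTC_oo F f a b l r : a < b ->
  {in `]a, b[, forall x : R, is_derive x 1 F (f x)} ->
  {in `]a, b[, continuous f} ->
  {in `]a, b[, forall x, 0 <= f x} ->
  F x @[x --> a^'+] --> l -> F x @[x --> b^'-] --> r ->
  (\int[mu]_(x in `]a, b[) (f x)%:E = (r - l)%:E)%E.
Proof.
move=> ab dF cf f0 Fl Fr.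
(* One third of the length keeps the closed intervals nondegenerate from n = 0 on, since
   [harmonic n] is at most 1. *)
pose d := (b - a) / 3.
have d0 : 0 < d by rewrite /d; lra.
have dE : b = a + d + d + d by rewrite /d; field.
pose an n := a + d * harmonic n; pose bn n := b - d * harmonic n.
have hd n : 0 < d * (@harmonic R n) <= d.
  have h1 : @harmonic R n <= 1 by rewrite invf_le1 ?ler1n.
  by rewrite mulr_gt0 ?harmonic_gt0 // ler_piMr // ltW.
have sub n x : x \in `[an n, bn n] -> x \in `]a, b[.
  rewrite !in_itv /= /an /bn; have := hd n => /andP[? ?] /andP[? ?].
  by apply/andP; split; lra.
have anbn n : an n < bn n.
  by rewrite /an /bn; have := hd n => /andP[? ?]; lra.
have cvgd : (fun n => d * (@harmonic R n)) @ \oo --> 0.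
  rewrite -[X in _ --> X](mulr0 d); apply: cvgM; first exact: cvg_cst.
  exact: cvg_harmonic.
have cvgan : an @ \oo --> a.
  rewrite -[X in _ --> X]addr0; apply: cvgD => //; exact: cvg_cst.
have cvgbn : bn @ \oo --> b.
  rewrite -[X in _ --> X]subr0; apply: cvgB => //; exact: cvg_cst.
have cF x : x \in `]a, b[ -> {for x, continuous F}.
  move=> /dF dFx; apply/differentiable_continuous/derivable1_diffP.
  exact: ex_derive.
have FTC n :
    (\int[mu]_(x in `[an n, bn n]) (f x)%:E = (F (bn n) - F (an n))%:E)%E.
  rewrite EFinB; apply: continuous_FTC2 => //.
  - by apply: continuous_in_subspaceT => x /[!inE] /sub /cf.
  - have inan : an n \in `[an n, bn n] by rewrite in_itv /= lexx ltW.
    have inbn : bn n \in `[an n, bn n] by rewrite in_itv /= lexx ltW.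
    split.
    + move=> x /subset_itv_oo_cc /sub /dF dFx; exact: ex_derive.
    + by apply: cvg_at_right_filter; apply: cF; exact: sub inan.
    + by apply: cvg_at_left_filter; apply: cF; exact: sub inbn.
  - move=> x /subset_itv_oo_cc /sub /dF dFx.
    by rewrite derive1E; exact: derive_val.
have bigE : \bigcup_n `[an n, bn n]%classic = `]a, b[%classic.
  apply/seteqP; split => [x [n _] /sub //|x].
  rewrite /= in_itv /= => /andP[ax xb].
  have : \forall n \near \oo, an n < x /\ x < bn n.
    near=> n; split; near: n.
      exact: cvgr_lt cvgan _ ax.
    exact: cvgr_gt cvgbn _ xb.
  move=> [N _ /(_ N (leqnn N)) [aNx xbN]]; exists N => //=.
  by rewrite in_itv /= !ltW.
have cvg1 : (\int[mu]_(x in `[an n, bn n]) (f x)%:E @[n --> \oo] -->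
    \int[mu]_(x in `]a, b[) (f x)%:E)%E.
  rewrite -bigE; apply: ge0_nondecreasing_set_cvg_integral => //.
  - move=> m n mn; rewrite subsetEset => x /=; rewrite !in_itv /= => /andP[H1 H2].
    have : d * (@harmonic R n) <= d * (@harmonic R m).
      by rewrite ler_pM2l //= lef_pV2 ?posrE // ler_nat.
    by move: H1 H2; rewrite /an /bn => H1 H2 H3; apply/andP; split; lra.
  - move=> n; apply/measurable_EFinP.
    apply: subspace_continuous_measurable_fun => //.
    by apply: continuous_in_subspaceT => x /[!inE] /sub /cf.
  - by move=> n x /= /sub /f0; rewrite lee_fin.
apply: (cvg_unique _ cvg1) => //=.
under eq_cvg do rewrite FTC.
apply: cvg_EFin; first exact: nearW.
apply: cvgB.
- move/cvg_at_leftP: Fr; apply; split => // n.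
  by rewrite /bn; have := hd n => /andP[? ?]; lra.
- move/cvg_at_rightP: Fl; apply; split => // n.
  by rewrite /an; have := hd n => /andP[? ?]; lra.
Unshelve. all: by end_near.
Qed.

(** A sign-changing [f] is reduced to the nonnegative case by adding its dominating function. The
    finite limits of the primitive [H] make [h] integrable, hence [f] as well. *)
Lemma dominated_FTC_oo F f H h a b (lF rF lH rH : R) : a < b ->
  {in `]a, b[, forall x : R, is_derive x 1 F (f x)} ->
  {in `]a, b[, continuous f} ->
  F x @[x --> a^'+] --> lF -> F x @[x --> b^'-] --> rF ->
  {in `]a, b[, forall x : R, is_derive x 1 H (h x)} ->
  {in `]a, b[, continuous h} ->
  H x @[x --> a^'+] --> lH -> H x @[x --> b^'-] --> rH ->
  {in `]a, b[, forall x, `|f x| <= h x} ->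
  mu.-integrable `]a, b[ (EFin \o h) /\
  \int[mu]_(x in `]a, b[) f x = rF - lF.
Proof.
move=> ab dF cf Fl Fr dH ch Hl Hr fh.
have h0 : {in `]a, b[, forall x, 0 <= h x}.
  by move=> x /fh; apply: le_trans.
have mh : measurable_fun `]a, b[ h.
  by apply: open_continuous_measurable_fun => // x /[!inE] /ch.
have mf : measurable_fun `]a, b[ f.
  by apply: open_continuous_measurable_fun => // x /[!inE] /cf.
have inth : mu.-integrable `]a, b[ (EFin \o h).
  apply/integrableP; split; first exact/measurable_EFinP.
  under eq_integral => x /[!inE] xab do rewrite /= ger0_norm ?h0 //.
  by rewrite (ge0_FTC_oo _ _ _ _ _ _ ab dH ch h0 Hl Hr) ltry.
have intf : mu.-integrable `]a, b[ (EFin \o f).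
  apply: le_integrable inth => //; first exact/measurable_EFinP.
  by move=> x /= xab; rewrite lee_fin (le_trans (fh _ xab)) // ler_norm.
split => //.
(* Both [h] and [f + h] are nonnegative. *)
have : \int[mu]_(x in `]a, b[) (f x + h x) = rF + rH - (lF + lH).
  rewrite /Rintegral (ge0_FTC_oo (F + H) (f + h) _ _ (lF + lH) (rF + rH)) //.
  - by move=> x xab; apply: is_deriveD; [exact: dF|exact: dH].
  - by move=> x xab; apply: cvgD; [exact: cf|exact: ch].
  - move=> x xab; rewrite [leRHS]/(f x + h x).
    by move: (fh _ xab); rewrite ler_norml => /andP[H1 _]; rewrite -lerBlDr sub0r.
  - exact: cvgD.
  - exact: cvgD.
have -> : rH = lH + \int[mu]_(x in `]a, b[) h x.
  rewrite /Rintegral (ge0_FTC_oo H h _ _ lH rH) //=; ring.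
rewrite RintegralD //; lra.
Qed.

Lemma powR_cvg0_comp (T : Type) (G : set_system T) (f : T -> R) (p : R) :
  Filter G -> 0 < p -> f @ G --> 0 -> (\forall x \near G, 0 <= f x) ->
  (fun x => f x `^ p) @ G --> 0.
Proof.
move=> FG p0 f0 fge0; apply/cvgr0Pnorm_lt => e e0.
have ep : 0 < e `^ (p^-1) by rewrite powR_gt0.
near=> x.
have fx0 : 0 <= f x by near: x.
rewrite ger0_norm ?powR_ge0 //.
have -> : e = (e `^ (p^-1)) `^ p.
  by rewrite -powRrM mulVf ?gt_eqF // powRr1 // ltW.
apply: gt0_ltr_powR => //; rewrite ?nnegrE ?ltW //.
near: x; exact: (cvgr_lt _ f0).
Unshelve. all: by end_near. Qed.

End ImproperFTC.

(** * Derivative and endpoint behaviour of the weight *)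

Section Weight.
Variable R : realType.
Variables (t eta lambda : R).
Hypothesis hlambda : - (1 / 2) < lambda.
Local Notation mu := (@lebesgue_measure R).
Local Notation w := (weight t eta lambda).
Local Notation D := `]0, 2 * pi[.

Lemma sin_half_gt0 (x : R) : x \in D -> 0 < sin (x / 2).
Proof.
by rewrite in_itv /= => /andP[x0 x1]; apply: sin_gt0_pi; apply/andP; split; lra.
Qed.

Lemma is_derive_mulr (k x : R) : is_derive x 1 ( *%R^~ k) k.
Proof.
have := is_deriveM (is_derive_id x (1 : R)) (is_derive_cst k x (1 : R)).
by move=> /is_derive_eq; apply; rewrite scaler0 add0r /cst /= [LHS]mulr1.
Qed.

Lemma is_derive_comp_mulr (f : R -> R) (k f' x : R) :
  is_derive (x * k) 1 f f' -> is_derive x 1 (fun y => f (y * k)) (f' * k).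
Proof.
move=> df; exact: (@is_derive1_comp _ f ( *%R^~ k) x _ _ df (is_derive_mulr k x)).
Qed.

Lemma is_derive_mul (f g : R -> R) (f' g' x : R) :
  is_derive x 1 f f' -> is_derive x 1 g g' ->
  is_derive x 1 (fun y => f y * g y) (f' * g x + f x * g').
Proof.
move=> df dg; have := is_deriveM df dg.
by move=> /is_derive_eq; apply; rewrite addrC mulrC.
Qed.

Lemma is_derive_weight (x : R) : x \in D ->
  is_derive x 1 w
   ((lambda * (cos (x / 2) / sin (x / 2)) - (t * sin x + eta)) * w x).
Proof.
move=> xD; have s0 := sin_half_gt0 _ xD.
have d1 : is_derive x 1 (fun y => expR (t * cos y))
    (expR (t * cos x) * (- sin x * t)).
  have dt := is_derive_cst t x (1 : R).
  have dc := is_derive_mul _ _ _ _ _ dt (is_derive_cos x).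
  have := @is_derive1_comp _ expR _ x _ _ (is_derive_expR _) dc.
  by move=> /is_derive_eq; apply; rewrite /cst /=; ring.
have d2 : is_derive x 1 (fun y => expR (- (eta * y)))
    (expR (- (eta * x)) * - eta).
  have de : is_derive x 1 (fun y => - (eta * y)) (- eta).
    have := is_derive_mulr (- eta) x; congr (is_derive _ _ _ _).
    by apply/funext => y /=; ring.
  exact: (@is_derive1_comp _ expR _ x _ _ (is_derive_expR _) de).
have ds := is_derive_comp_mulr _ 2^-1 _ _ (is_derive_sin (x / 2)).
have dss := is_derive_mul _ _ _ _ _ ds ds.
have ss0 : 0 < sin (x / 2) ^+ 2 by rewrite exprn_gt0.
have d3 : is_derive x 1 (fun y => (sin (y / 2) ^+ 2) `^ lambda)
    (lambda * (cos (x / 2) / sin (x / 2)) * (sin (x / 2) ^+ 2) `^ lambda).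
  have dp := @is_derive1_powR _ lambda _ ss0.
  have := @is_derive1_comp _ (@powR R ^~ lambda) _ x _ _ dp dss.
  move=> /is_derive_eq; apply.
  rewrite powRB ?(gt_eqF ss0) ?implybT // powRr1 ?(ltW ss0) //.
  have sn0 : sin (x / 2) != 0 by rewrite gt_eqF.
  by field.
have := is_derive_mul _ _ _ _ _ (is_derive_mul _ _ _ _ _ d1 d2) d3.
by move=> /is_derive_eq; apply; rewrite /weight; ring.
Qed.

Lemma weight_ge0 x : 0 <= w x.
Proof. by rewrite /weight !mulr_ge0 ?expR_ge0 ?powR_ge0. Qed.

Lemma continuous_weight (x : R) : x \in D -> {for x, continuous w}.
Proof.
move=> /is_derive_weight dw.
apply/differentiable_continuous/derivable1_diffP; exact: ex_derive.
Qed.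

(** The factor sin(x/2) absorbs the pole of the cotangent in w'/w, leaving a regular factor times
    the weight. In lambda + 1/2, the 1/2 comes from differentiating sin(x/2). *)
Lemma is_derive_sin_weight (g : R -> R) (g' x : R) : x \in D ->
  is_derive x 1 g g' ->
  is_derive x 1 (fun y => g y * (sin (y / 2) * w y))
   ((g' * sin (x / 2) + (lambda + 1 / 2) * (g x * cos (x / 2))
     - g x * sin (x / 2) * (t * sin x + eta)) * w x).
Proof.
move=> xD dg; have s0 := sin_half_gt0 _ xD.
have ds := is_derive_comp_mulr _ 2^-1 _ _ (is_derive_sin (x / 2)).
have dsw := is_derive_mul _ _ _ _ _ ds (is_derive_weight _ xD).
have := is_derive_mul _ _ _ _ _ dg dsw.
move=> /is_derive_eq; apply; have sn0 : sin (x / 2) != 0 by rewrite gt_eqF.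
by field.
Qed.

(** On the open interval the product is a continuous exponential factor times the power lambda + 1/2
    of sin^2(x/2), and this exponent is positive. A general filter serves both endpoints. *)
Lemma sin_weight_cvg0 (G : set_system R) (l : R) : Filter G ->
  x @[x --> G] --> l -> sin (l / 2) = 0 -> (\forall x \near G, x \in D) ->
  sin (x / 2) * w x @[x --> G] --> 0.
Proof.
move=> FG Gl sl0 GD.
have cvgs : sin (x / 2) @[x --> G] --> 0.
  rewrite -sl0; apply: continuous_cvg; first exact: continuous_sin.
  by apply: cvgM => //; exact: cvg_cst.
have cvgp : (sin (x / 2) ^+ 2) `^ (lambda + 1 / 2) @[x --> G] --> 0.
  have p0 : 0 < lambda + 1 / 2 by move: hlambda => ?; lra.
  apply: (powR_cvg0_comp _ _ _ _ _ _ p0).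
  - by rewrite -(mulr0 0); apply: cvgM.
  - by near=> x; rewrite sqr_ge0.
pose E x := expR (t * cos x) * expR (- (eta * x)).
have cvgE : E x @[x --> G] --> E l.
  apply: cvgM; apply: continuous_cvg; try exact: continuous_expR.
    apply: cvgM; first exact: cvg_cst.
    by apply: continuous_cvg => //; exact: continuous_cos.
  by apply: cvgN; apply: cvgM => //; exact: cvg_cst.
rewrite -(mulr0 (E l)).
apply: cvg_trans (cvgM cvgE cvgp); apply: near_eq_cvg; near=> x.
have xD : x \in D by near: x.
have s0 := sin_half_gt0 _ xD.
rewrite /= /weight -/(E x) powRD; last first.
  by rewrite (gt_eqF (exprn_gt0 _ s0)) implybT.
rewrite div1r powR12_sqrt ?sqr_ge0 // sqrtr_sqr gtr0_norm //.
by ring.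
Unshelve. all: by end_near. Qed.
End Weight.

(** * Bounded continuous factors *)

Section BoundedContinuous.
Variable R : realType.

(** The class of factors allowed in front of the weight: continuity gives measurability of the
    product, boundedness gives domination by a multiple of the weight. *)
Definition bounded_continuous (q : R -> R) :=
  continuous q /\ exists M, forall x, `|q x| <= M.

Lemma bounded_continuous_cst k : bounded_continuous (fun=> k).
Proof. by split; [move=> x; exact: cvg_cst | exists `|k|]. Qed.

Lemma bounded_continuousD p q : bounded_continuous p -> bounded_continuous q ->
  bounded_continuous (fun x => p x + q x).
Proof.
move=> [cp [M pM]] [cq [N qN]]; split.
  by move=> x; apply: cvgD; [exact: cp|exact: cq].
by exists (M + N) => x; rewrite (le_trans (ler_normD _ _)) // lerD.
Qed.

Lemma bounded_continuousM p q : bounded_continuous p -> bounded_continuous q ->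
  bounded_continuous (fun x => p x * q x).
Proof.
move=> [cp [M pM]] [cq [N qN]]; split.
  by move=> x; apply: cvgM; [exact: cp|exact: cq].
by exists (M * N) => x; rewrite normrM ler_pM.
Qed.

Lemma bounded_continuousN p : bounded_continuous p ->
  bounded_continuous (fun x => - p x).
Proof.
move=> [cp [M pM]]; split; first by move=> x; apply: cvgN; exact: cp.
by exists M => x; rewrite normrN.
Qed.

Lemma bounded_continuousB p q : bounded_continuous p -> bounded_continuous q ->
  bounded_continuous (fun x => p x - q x).
Proof. by move=> bp bq; apply/bounded_continuousD/bounded_continuousN. Qed.

Lemma bounded_continuous_cos k : bounded_continuous (fun x => cos (x * k)).
Proof.
split; last by exists 1 => x; exact: cos_max.
move=> x; apply: continuous_comp; last exact: continuous_cos.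
by apply: cvgM => //; exact: cvg_cst.
Qed.

Lemma bounded_continuous_sin k : bounded_continuous (fun x => sin (x * k)).
Proof.
split; last by exists 1 => x; exact: sin_max.
move=> x; apply: continuous_comp; last exact: continuous_sin.
by apply: cvgM => //; exact: cvg_cst.
Qed.

End BoundedContinuous.

(** * Integrability against the weight and integration by parts *)

Section WeightIntegral.
Variable R : realType.
Variables (t eta lambda : R).
Hypothesis hlambda : - (1 / 2) < lambda.
Local Notation mu := (@lebesgue_measure R).
Local Notation w := (weight t eta lambda).
Local Notation D := `]0, 2 * pi[.

(* [dom] has the elementary primitive [Dom], which is continuous on the closed
   interval, and dominates a positive multiple of the weight: this controls the
   endpoint singularities of the weight when lambda < 0. *)
Let dom (x : R) := ((lambda + 1 / 2) - (lambda + 1) * sin (x / 2) ^+ 2)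
  * weight 0 0 lambda x + (lambda + 1).
Let Dom (x : R) :=
  cos (x / 2) * (sin (x / 2) * weight 0 0 lambda x) + (lambda + 1) * x.

Let two_pi_gt0 : 0 < 2 * pi :> R.
Proof. by rewrite mulr_gt0 // pi_gt0. Qed.

Let near_D_right : \forall x \near (0 : R)^'+, x \in D.
Proof.
near=> x; rewrite in_itv /=; apply/andP; split; near: x.
  exact: nbhs_right_gt.
exact: nbhs_right_lt.
Unshelve. all: by end_near. Qed.

Let near_D_left : \forall x \near (2 * pi : R)^'-, x \in D.
Proof.
near=> x; rewrite in_itv /=; apply/andP; split; near: x.
  exact: nbhs_left_gt.
exact: nbhs_left_lt.
Unshelve. all: by end_near. Qed.

Let right_id : x @[x --> (0 : R)^'+] --> (0 : R).
Proof. exact: cvg_at_right_filter. Qed.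

Let left_id : x @[x --> (2 * pi : R)^'-] --> (2 * pi : R).
Proof. exact: cvg_at_left_filter. Qed.

Let sin_half_2pi : sin (2 * pi / 2) = 0 :> R.
Proof. by rewrite mulrAC divff ?mul1r ?sinpi. Qed.

Let sin_half_0 : sin (0 / 2) = 0 :> R.
Proof. by rewrite mul0r sin0. Qed.

(** The parameters t' and eta' are free because the limit is needed both for the weight itself and
    for the comparison weight with t = eta = 0. *)
Lemma mul_sin_weight_cvg_right t' eta' (g : R -> R) : continuous g ->
  g x * (sin (x / 2) * weight t' eta' lambda x) @[x --> (0 : R)^'+] --> (0 : R).
Proof.
move=> cg; rewrite -[X in _ --> X](mulr0 (g 0)); apply: cvgM.
  by apply: cvg_at_right_filter; exact: cg.
exact: (sin_weight_cvg0 _ _ _ _ hlambda _ _ _ right_id sin_half_0 near_D_right).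
Qed.

Lemma mul_sin_weight_cvg_left t' eta' (g : R -> R) : continuous g ->
  g x * (sin (x / 2) * weight t' eta' lambda x) @[x --> (2 * pi : R)^'-] -->
    (0 : R).
Proof.
move=> cg; rewrite -[X in _ --> X](mulr0 (g (2 * pi))); apply: cvgM.
  by apply: cvg_at_left_filter; exact: cg.
exact: (sin_weight_cvg0 _ _ _ _ hlambda _ _ _ left_id sin_half_2pi near_D_left).
Qed.

Let Dom_right : Dom x @[x --> (0 : R)^'+] --> (0 : R).
Proof.
rewrite -[X in _ --> X]addr0; apply: cvgD.
  exact: mul_sin_weight_cvg_right (bounded_continuous_cos _ _).1.
by rewrite -[X in _ --> X](mulr0 (lambda + 1)); apply: cvgM => //; exact: cvg_cst.
Qed.

Let Dom_left : Dom x @[x --> (2 * pi : R)^'-] --> (lambda + 1) * (2 * pi).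
Proof.
rewrite -[X in _ --> X]add0r; apply: cvgD.
  exact: mul_sin_weight_cvg_left (bounded_continuous_cos _ _).1.
by apply: cvgM => //; exact: cvg_cst.
Qed.

Let is_derive_Dom (x : R) : x \in D -> is_derive x 1 Dom (dom x).
Proof.
move=> xD.
have dc := is_derive_comp_mulr _ _ 2^-1 _ _ (is_derive_cos (x / 2)).
have dsw := is_derive_sin_weight _ 0 0 lambda _ _ _ xD dc.
have dl := is_derive_cst (lambda + 1) x 1.
have := is_deriveD dsw (is_derive_mul _ _ _ _ _ _ dl (is_derive_id x 1)).
move=> /is_derive_eq; apply; rewrite /dom /cst.
(* With g = cos(x/2) the derivative has the factor (lambda + 1/2) cos^2 - sin^2 / 2, which is the
   factor in [dom] once cos^2 is eliminated. *)
by have c2 := cos2sin2 (x / 2); field: c2.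
Qed.

(** The product of sin^2(x/2) and the comparison weight is a power of sin^2(x/2) with positive
    exponent lambda + 1, hence at most 1; the constant lambda + 1 in [dom] pays for the subtracted
    term. *)
Let weight_dom (x : R) : x \in D ->
  (lambda + 1 / 2) * weight 0 0 lambda x <= dom x.
Proof.
move=> xD; have s0 := sin_half_gt0 _ _ xD.
have hl : 0 < lambda + 1 by move: hlambda => ?; lra.
have w00 : weight 0 0 lambda x = (sin (x / 2) ^+ 2) `^ lambda.
  by rewrite /weight !mul0r oppr0 expR0 !mul1r.
have sw : sin (x / 2) ^+ 2 * weight 0 0 lambda x <= 1.
  rewrite w00 -[X in X * _]powRr1 ?sqr_ge0 // -powRD; last first.
    by rewrite (gt_eqF (exprn_gt0 _ s0)) implybT.
  apply: (@le_trans _ _ (1 `^ (1 + lambda))); last by rewrite powR1.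
  have s1 : sin (x / 2) ^+ 2 <= 1 by rewrite sin2cos2 lerBlDr lerDl sqr_ge0.
  by apply: ge0_ler_powR; rewrite ?nnegrE ?sqr_ge0 // addrC ltW.
have : (lambda + 1) * (sin (x / 2) ^+ 2 * weight 0 0 lambda x) <= lambda + 1.
  by rewrite ler_piMr // ltW.
rewrite /dom; lra.
Qed.

Let weight_le (x : R) : x \in D ->
  w x <= expR `|t| * expR (`|eta| * (2 * pi)) * weight 0 0 lambda x.
Proof.
rewrite in_itv /= => /andP[x0 x1].
rewrite [leLHS]/weight [X in _ <= _ * X]/weight !mul0r oppr0 expR0 !mul1r.
apply: ler_wpM2r; first exact: powR_ge0.
apply: ler_pM; rewrite ?expR_ge0 // ler_expR.
  by rewrite (le_trans (ler_norm _)) // normrM ler_piMr // cos_max.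
rewrite (le_trans (ler_norm _)) // normrN normrM ler_wpM2l //.
by rewrite gtr0_norm // ltW.
Qed.

Let weight_bound : exists2 K, 0 < K & forall x, x \in D -> w x <= K * dom x.
Proof.
have hl : 0 < lambda + 1 / 2 by move: hlambda => ?; lra.
pose K0 := expR `|t| * expR (`|eta| * (2 * pi)).
have K0gt : 0 < K0 by rewrite mulr_gt0 ?expR_gt0.
exists (K0 / (lambda + 1 / 2)); first by rewrite divr_gt0.
move=> x xD; apply: le_trans (weight_le _ xD) _.
rewrite -/K0 -[leRHS]mulrA ler_pM2l // ler_pdivlMl //; exact: weight_dom.
Qed.

Let continuous_dom (x : R) : x \in D -> {for x, continuous dom}.
Proof.
move=> xD; apply: cvgD; last exact: cvg_cst.
apply: cvgM; last exact: continuous_weight.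
apply: cvgB; first exact: cvg_cst.
apply: cvgM; first exact: cvg_cst.
by apply: cvgM; exact: (bounded_continuous_sin _ _).1.
Qed.

Let continuous_mul_weight (q : R -> R) (x : R) : continuous q ->
  x \in D -> {for x, continuous (fun x => q x * w x)}.
Proof. by move=> cq xD; apply: cvgM; [exact: cq|exact: continuous_weight]. Qed.

Let mul_weight_bound (q : R -> R) : bounded_continuous _ q ->
  exists K, forall x, x \in D -> `|q x * w x| <= K * dom x.
Proof.
move=> [_ [M qM]]; have [K K0 wK] := weight_bound; exists (M * K) => x xD.
rewrite normrM (ger0_norm (weight_ge0 _ _ _ _ x)) -mulrA.
by rewrite ler_pM ?weight_ge0 // wK.
Qed.

Let is_derive_scaleDom (K x : R) : x \in D ->
  is_derive x 1 (fun x => K * Dom x) (K * dom x).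
Proof.
move=> xD; have dK := is_derive_cst K x 1.
have := is_derive_mul _ _ _ _ _ _ dK (is_derive_Dom _ xD).
by move=> /is_derive_eq; apply; rewrite mul0r add0r.
Qed.

Let continuous_scaledom (K x : R) : x \in D ->
  {for x, continuous (fun x => K * dom x)}.
Proof. by move=> xD; apply: cvgM; [exact: cvg_cst|exact: continuous_dom]. Qed.

Let scaleDom_right (K : R) : K * Dom x @[x --> (0 : R)^'+] --> K * 0.
Proof. by apply: cvgM; [exact: cvg_cst|exact: Dom_right]. Qed.

Let scaleDom_left (K : R) :
  K * Dom x @[x --> (2 * pi : R)^'-] --> K * ((lambda + 1) * (2 * pi)).
Proof. by apply: cvgM; [exact: cvg_cst|exact: Dom_left]. Qed.

Lemma weight_FTC (F q : R -> R) : bounded_continuous _ q ->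
  (forall x : R, x \in D -> is_derive x 1 F (q x * w x)) ->
  F x @[x --> (0 : R)^'+] --> (0 : R) ->
  F x @[x --> (2 * pi : R)^'-] --> (0 : R) ->
  \int[mu]_(x in [set` D]) (q x * w x) = 0.
Proof.
move=> bq dF Fl Fr; have [K qwK] := mul_weight_bound _ bq.
have [_ ->] := dominated_FTC_oo _ _ _ _ _ _ _ _ _ _ _ two_pi_gt0 dF
  (fun x => continuous_mul_weight _ x bq.1) Fl Fr
  (is_derive_scaleDom K) (continuous_scaledom K)
  (scaleDom_right K) (scaleDom_left K) qwK.
by rewrite subr0.
Qed.

Lemma integrable_mul_weight (q : R -> R) : bounded_continuous _ q ->
  mu.-integrable [set` D] (EFin \o (fun x => q x * w x)).
Proof.
move=> bq; have [K qwK] := mul_weight_bound _ bq.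
(* The dominated theorem is applied to the zero function, only to extract the integrability of K *
   dom. *)
have K0 (x : R) : x \in D -> `|cst (0 : R) x| <= K * dom x.
  by move=> xD; rewrite normr0 (le_trans _ (qwK _ xD)).
have c0 (x : R) : x \in D -> {for x, continuous (cst (0 : R))}.
  by move=> _; exact: cvg_cst.
have c0r : cst (0 : R) x @[x --> (0 : R)^'+] --> (0 : R) by exact: cvg_cst.
have c0l : cst (0 : R) x @[x --> (2 * pi : R)^'-] --> (0 : R) by exact: cvg_cst.
have [inth _] := dominated_FTC_oo _ _ _ _ _ _ _ _ _ _ _ two_pi_gt0
  (fun x _ => is_derive_cst (0 : R) x 1) c0 c0r c0l
  (is_derive_scaleDom K) (continuous_scaledom K)
  (scaleDom_right K) (scaleDom_left K) K0.
apply: le_integrable inth => //.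
  apply/measurable_EFinP; apply: open_continuous_measurable_fun => //.
  by move=> x /[!inE] xD; exact: continuous_mul_weight bq.1 xD.
by move=> x /= xD; rewrite lee_fin (le_trans (qwK _ xD)) // ler_norm.
Qed.

(** The integrand is the derivative of g(x) sin(x/2) w(x), which tends to 0 at both endpoints. *)
Lemma weight_ibp (g g' : R -> R) :
  bounded_continuous _ g -> bounded_continuous _ g' ->
  (forall x : R, is_derive x 1 g (g' x)) ->
  \int[mu]_(x in [set` D])
    ((g' x * sin (x / 2) + (lambda + 1 / 2) * (g x * cos (x / 2))
     - g x * sin (x / 2) * (t * sin x + eta)) * w x) = 0.
Proof.
move=> bg bg' dg; apply: (weight_FTC (fun x => g x * (sin (x / 2) * w x))).
- have bs : bounded_continuous _ (@sin R).
    have := bounded_continuous_sin R 1; congr (bounded_continuous _ _).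
    by apply/funext => x; rewrite mulr1.
  apply: bounded_continuousB; first apply: bounded_continuousD.
  + by apply: bounded_continuousM => //; exact: bounded_continuous_sin.
  + apply: bounded_continuousM; first exact: bounded_continuous_cst.
    by apply: bounded_continuousM => //; exact: bounded_continuous_cos.
  + apply: bounded_continuousM.
      by apply: bounded_continuousM => //; exact: bounded_continuous_sin.
    apply: bounded_continuousD; last exact: bounded_continuous_cst.
    by apply: bounded_continuousM => //; exact: bounded_continuous_cst.
- by move=> x xD; exact: is_derive_sin_weight.
- exact: mul_sin_weight_cvg_right bg.1.
- exact: mul_sin_weight_cvg_left bg.1.
Qed.

End WeightIntegral.

(** * The exponential on the unit circle *)

Section Expi.
Variable R : realType.

Lemma expiD (x y : R) : expi (x + y) = expi x * expi y.
Proof. by rewrite /expi sinD cosD; simpc; congr (_ +i* _); rewrite addrC. Qed.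

Lemma expi0 : expi (0 : R) = 1.
Proof. by rewrite /expi sin0 cos0. Qed.

Lemma conj_expi (x : R) : Num.conj (expi x) = expi (- x).
Proof. by rewrite /expi sinN cosN. Qed.

Lemma expi_expn (x : R) n : expi x ^+ n = expi (x * n%:R).
Proof.
elim: n => [|n IH]; first by rewrite mulr0 expi0.
by rewrite exprS IH -expiD -natr1 mulrDr mulr1 addrC.
Qed.

Lemma expi_conjK (x : R) : expi x * Num.conj (expi x) = 1.
Proof. by rewrite conj_expi -expiD subrr expi0. Qed.

Definition cbounded_continuous (f : R -> R[i]) :=
  bounded_continuous _ (fun x => complex.Re (f x)) /\
  bounded_continuous _ (fun x => complex.Im (f x)).

Lemma cbounded_continuous_cst c : cbounded_continuous (fun=> c).
Proof. by split; exact: bounded_continuous_cst. Qed.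

Lemma cbounded_continuousD f g : cbounded_continuous f ->
  cbounded_continuous g -> cbounded_continuous (fun x => f x + g x).
Proof.
move=> [f1 f2] [g1 g2]; split.
- have := bounded_continuousD _ _ _ f1 g1; congr (bounded_continuous _ _).
  by apply/funext => x; case: (f x) (g x) => ? ? [].
- have := bounded_continuousD _ _ _ f2 g2; congr (bounded_continuous _ _).
  by apply/funext => x; case: (f x) (g x) => ? ? [].
Qed.

Lemma cbounded_continuousM f g : cbounded_continuous f ->
  cbounded_continuous g -> cbounded_continuous (fun x => f x * g x).
Proof.
move=> [f1 f2] [g1 g2]; split.
- have := bounded_continuousB _ _ _ (bounded_continuousM _ _ _ f1 g1)
    (bounded_continuousM _ _ _ f2 g2); congr (bounded_continuous _ _).
  by apply/funext => x; case: (f x) (g x) => ? ? [].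
- have := bounded_continuousD _ _ _ (bounded_continuousM _ _ _ f1 g2)
    (bounded_continuousM _ _ _ f2 g1); congr (bounded_continuous _ _).
  by apply/funext => x; case: (f x) (g x) => ? ? [].
Qed.

Lemma cbounded_continuous_conj f : cbounded_continuous f ->
  cbounded_continuous (fun x => Num.conj (f x)).
Proof.
move=> [f1 f2]; split.
- move: f1; congr (bounded_continuous _ _).
  by apply/funext => x; case: (f x).
- have := bounded_continuousN _ _ f2; congr (bounded_continuous _ _).
  by apply/funext => x; case: (f x).
Qed.

Lemma cbounded_continuous_expi k : cbounded_continuous (fun x => expi (x * k)).
Proof.
by split; [exact: bounded_continuous_cos|exact: bounded_continuous_sin].
Qed.

Lemma cbounded_continuous_horner (p : {poly R[i]}) :
  cbounded_continuous (fun x => p.[expi x]).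
Proof.
elim/poly_ind: p => [|p c IH].
  have := cbounded_continuous_cst 0; congr cbounded_continuous.
  by apply/funext => x; rewrite horner0.
have := cbounded_continuousD _ _ (cbounded_continuousM _ _ IH
  (cbounded_continuous_expi 1)) (cbounded_continuous_cst c).
by congr cbounded_continuous; apply/funext => x; rewrite hornerMXaddC mulr1.
Qed.

End Expi.

(** * Weighted circle integrals and the moment identity *)

Section WeightedCircleIntegral.
Variable R : realType.
Variables (t eta lambda : R).
Hypothesis hlambda : - (1 / 2) < lambda.
Local Notation mu := (@lebesgue_measure R).
Local Notation w := (weight t eta lambda).
Local Notation D := `]0, 2 * pi[.
Local Notation b := (lambda +i* eta).
Local Notation t2 := ((t / 2)%:C).

Let J (q : R -> R) := \int[mu]_(x in [set` D]) (q x * w x).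
Let CI (f : R -> R[i]) := circle_integral (fun x => f x * (w x)%:C).

Let integrableJ := integrable_mul_weight R t eta lambda hlambda.

(** Dropping the two endpoints, a null set, replaces the closed interval of [circle_integral] by the
    open one, where the weight is differentiable. *)
Let CI_parts f : cbounded_continuous _ f ->
  CI f = J (fun x => complex.Re (f x)) +i* J (fun x => complex.Im (f x)).
Proof.
move=> [f1 f2]; rewrite /CI /circle_integral; congr (_ +i* _).
- rewrite /J /Rintegral -(integral_itv_bndoo true false) //; last first.
    exact: measurable_int (integrableJ _ f1).
  congr fine; apply: eq_integral => x _.
  by case: (f x) => u v; rewrite /= mulr0 subr0.
- rewrite /J /Rintegral -(integral_itv_bndoo true false) //; last first.
    exact: measurable_int (integrableJ _ f2).
  congr fine; apply: eq_integral => x _.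
  by case: (f x) => u v; rewrite /= mulr0 add0r.
Qed.

Let J_linear (a : R) q1 q2 : bounded_continuous _ q1 -> bounded_continuous _ q2 ->
  J (fun x => a * q1 x + q2 x) = a * J q1 + J q2.
Proof.
move=> b1 b2; rewrite /J -RintegralZl //; last exact: integrableJ.
rewrite -RintegralD //; last 2 first.
- have ba := bounded_continuous_cst _ a.
  have := integrableJ _ (bounded_continuousM _ _ _ ba b1).
  by congr (integrable _ _ _); apply/funext => x /=; rewrite mulrA.
- exact: integrableJ.
by apply: eq_Rintegral => x _; ring.
Qed.

Lemma circle_integral_linear c f g :
  cbounded_continuous _ f -> cbounded_continuous _ g ->
  CI (fun x => c * f x + g x) = c * CI f + CI g.
Proof.
move=> bf bg; rewrite !CI_parts //; last first.
  apply: cbounded_continuousD => //; apply: cbounded_continuousM => //.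
  exact: cbounded_continuous_cst.
have [[f1 f2] [g1 g2]] := (bf, bg); case: c => c1 c2.
simpc; congr (_ +i* _).
- transitivity (J (fun x => c1 * complex.Re (f x) +
    ((- c2) * complex.Im (f x) + complex.Re (g x)))).
    by congr J; apply/funext => x; case: (f x) (g x) => ? ? [? ?] /=; ring.
  rewrite !J_linear //; first ring.
  apply: bounded_continuousD => //; apply: bounded_continuousM => //.
  exact: bounded_continuous_cst.
- transitivity (J (fun x => c1 * complex.Im (f x) +
    (c2 * complex.Re (f x) + complex.Im (g x)))).
    by congr J; apply/funext => x; case: (f x) (g x) => ? ? [? ?] /=; ring.
  rewrite !J_linear //; first ring.
  apply: bounded_continuousD => //; apply: bounded_continuousM => //.
  exact: bounded_continuous_cst.
Qed.

Lemma circle_integral_conj f : cbounded_continuous _ f ->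
  CI (fun x => Num.conj (f x)) = Num.conj (CI f).
Proof.
move=> bf; rewrite !CI_parts //; last exact: cbounded_continuous_conj.
have [f1 f2] := bf.
transitivity (J (fun x => complex.Re (f x)) +i*
  J (fun x => -1 * complex.Im (f x) + 0)).
  by congr (J _ +i* J _); apply/funext => x; case: (f x) => ? ? //=; ring.
rewrite J_linear //; last exact: bounded_continuous_cst.
have -> : J (fun=> 0) = 0.
  rewrite /J; under eq_Rintegral do rewrite mul0r.
  by rewrite /Rintegral integral0.
by rewrite addr0 mulN1r.
Qed.

Let CI0 : CI (fun=> 0) = 0.
Proof.
have c0 := cbounded_continuous_cst R 0.
have := circle_integral_linear 1 _ _ c0 c0.
have -> : (fun _ : R => 1 * 0 + 0) = (fun=> 0) :> (R -> R[i]).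
  by apply/funext => x; rewrite mulr0 addr0.
rewrite mul1r.
by move=> /(congr1 (fun u => u - CI (fun=> 0))); rewrite subrr addrK.
Qed.

Let CI_scale c f : cbounded_continuous _ f -> c * CI f = CI (fun x => c * f x).
Proof.
move=> bf; rewrite -[LHS]addr0 -CI0 -circle_integral_linear //; last first.
  exact: cbounded_continuous_cst.
by congr CI; apply/funext => x; rewrite addr0.
Qed.

(** The integral of the derivative of z^k (z - 1) w, divided by i and expanded in powers of z =
    e^(ix). A real exponent [k] also covers the negative differences of degrees needed later. *)
Lemma circle_integral_pearson k :
  (k%:C + 1 + b - t2) * CI (fun x => expi (x * (k + 1)))
  + ((Num.conj b - k%:C - t2) * CI (fun x => expi (x * k))
  + (t2 * CI (fun x => expi (x * (k + 2)))
  + t2 * CI (fun x => expi (x * (k - 1))))) = 0.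
Proof.
have be := cbounded_continuous_expi R.
have bc c f : cbounded_continuous _ f -> cbounded_continuous R (fun x => c * f x).
  by move=> ?; apply: cbounded_continuousM => //; exact: cbounded_continuous_cst.
have b4 := bc t2 _ (be (k - 1)).
have b3 := cbounded_continuousD _ _ _ (bc t2 _ (be (k + 2))) b4.
have b2 := cbounded_continuousD _ _ _ (bc (Num.conj b - k%:C - t2) _ (be k)) b3.
have b1 := cbounded_continuousD _ _ _ (bc (k%:C + 1 + b - t2) _ (be (k + 1))) b2.
rewrite (CI_scale _ _ (be (k - 1))).
rewrite -(circle_integral_linear _ _ _ (be (k + 2)) b4).
rewrite -(circle_integral_linear _ _ _ (be k) b3).
rewrite -(circle_integral_linear _ _ _ (be (k + 1)) b2) (CI_parts _ b1).
(* z^k (z - 1) = sin(x/2) * 2i e^(i ph x), so the real and imaginary parts follow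
   from [weight_ibp] applied to 2 cos(ph x) and 2 sin(ph x). *)
pose ph := k + 1 / 2.
have b2' := bounded_continuous_cst R 2.
have bcos := bounded_continuousM _ _ _ b2' (bounded_continuous_cos _ ph).
have bsin := bounded_continuousM _ _ _ b2' (bounded_continuous_sin _ ph).
have dcos (x : R) :
    is_derive x 1 (fun x => 2 * cos (x * ph)) (- ph * (2 * sin (x * ph))).
  have df := is_derive_comp_mulr _ _ ph _ _ (is_derive_cos (x * ph)).
  have := is_derive_mul _ _ _ _ _ _ (is_derive_cst (2 : R) x 1) df.
  by move=> /is_derive_eq; apply; rewrite /cst; ring.
have dsin (x : R) :
    is_derive x 1 (fun x => 2 * sin (x * ph)) (ph * (2 * cos (x * ph))).
  have df := is_derive_comp_mulr _ _ ph _ _ (is_derive_sin (x * ph)).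
  have := is_derive_mul _ _ _ _ _ _ (is_derive_cst (2 : R) x 1) df.
  by move=> /is_derive_eq; apply; rewrite /cst; ring.
have bdcos := bounded_continuousM _ _ _ (bounded_continuous_cst _ (- ph)) bsin.
have bdsin := bounded_continuousM _ _ _ (bounded_continuous_cst _ ph) bcos.
have I1 := weight_ibp _ t eta _ hlambda _ _ bcos bdcos dcos.
have I2 := weight_ibp _ t eta _ hlambda _ _ bsin bdsin dsin.
have E (x : R) : (k%:C + 1 + b - t2) * expi (x * (k + 1))
    + ((Num.conj b - k%:C - t2) * expi (x * k)
    + (t2 * expi (x * (k + 2)) + t2 * expi (x * (k - 1)))) =
    (- ph * (2 * sin (x * ph)) * sin (x / 2) +
     (lambda + 1 / 2) * (2 * cos (x * ph) * cos (x / 2)) -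
     2 * cos (x * ph) * sin (x / 2) * (t * sin x + eta)) +i*
    (ph * (2 * cos (x * ph)) * sin (x / 2) +
     (lambda + 1 / 2) * (2 * sin (x * ph) * cos (x / 2)) -
     2 * sin (x * ph) * sin (x / 2) * (t * sin x + eta)).
  (* All angles are expressed through x k and x / 2, so that the addition formulas and cos^2 + sin^2
     = 1 leave an algebraic identity. *)
  have -> : sin x = sin (x / 2 + x / 2) by congr sin; field.
  have -> : x * (k + 1) = x * k + (x / 2 + x / 2) by field.
  have -> : x * (k + 2) = x * k + (x / 2 + x / 2) + (x / 2 + x / 2) by field.
  have -> : x * (k - 1) = x * k - (x / 2 + x / 2) by field.
  have -> : x * ph = x * k + x / 2 by rewrite /ph; field.
  have c2 := cos2sin2 (x / 2).
  apply/eqP; rewrite eq_complex /expi !(sinD, cosD, sinN, cosN) /= /ph.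
  by apply/andP; split; apply/eqP; field: c2.
rewrite -[RHS]/(0 +i* 0); congr (_ +i* _).
- by rewrite -[RHS]I1 /J; apply: eq_Rintegral => x _; rewrite E.
- by rewrite -[RHS]I2 /J; apply: eq_Rintegral => x _; rewrite E.
Qed.

(** * Properties of the inner product *)

Local Notation B p q := (opuc_inner w (horner p) (horner q)).
Implicit Types p q : {poly R[i]}.

Let cbounded_continuous_inner p q :
  cbounded_continuous _ (fun x => p.[expi x] * Num.conj q.[expi x]).
Proof.
apply: cbounded_continuousM; first exact: cbounded_continuous_horner.
by apply: cbounded_continuous_conj; exact: cbounded_continuous_horner.
Qed.

Lemma opuc_inner_linear q : linear_for *%R (fun p => B p q).
Proof.
move=> c p1 p2; have := circle_integral_linear c _ _
  (cbounded_continuous_inner p1 q) (cbounded_continuous_inner p2 q).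
move=> <-; congr CI; apply/funext => x.
by rewrite hornerD hornerZ mulrDl mulrA.
Qed.

Lemma opuc_inner_herm p q : B q p = Num.conj (B p q).
Proof.
have <- := circle_integral_conj _ (cbounded_continuous_inner p q).
by congr CI; apply/funext => x; rewrite rmorphM /= conjCK mulrC.
Qed.

Lemma opuc_inner_shift p q : B ('X * p) ('X * q) = B p q.
Proof.
congr CI; apply/funext => x; rewrite !hornerM hornerX rmorphM /=.
by rewrite mulrACA expi_conjK mul1r.
Qed.

Let opuc_inner_Xn m n : B 'X^m 'X^n = CI (fun x => expi (x * (m%:R - n%:R))).
Proof.
congr CI; apply/funext => x; rewrite !hornerXn !expi_expn conj_expi -expiD.
by rewrite mulrBr.
Qed.

(** A vanishing integral of |p|^2 w forces |p|^2 w = 0 almost everywhere, and w is positive inside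
    the interval. A nonzero p has finitely many roots, so an interval of positive length would be
    negligible. *)
Lemma opuc_inner_definite p : B p p = 0 -> p = 0.
Proof.
rewrite -[B p p]/(CI _) CI_parts // => /(congr1 (@complex.Re R)) /=.
set q := fun x => complex.Re _ => Jq0.
have bq : bounded_continuous _ q by case: (cbounded_continuous_inner p p).
have qE x : q x = complex.Re p.[expi x] ^+ 2 + complex.Im p.[expi x] ^+ 2.
  by rewrite /q; case: p.[expi x] => u v /=; rewrite mulrN opprK -!expr2.
have q0 x : 0 <= q x by rewrite qE addr_ge0 // sqr_ge0.
have intq := integrableJ _ bq.
have : ae_eq mu [set` D] (EFin \o (fun x => q x * w x)) (cst 0%E).
  apply/ae_eq_integral_abs => //; first exact: measurable_int intq.
  have I0 : (\int[mu]_(x in [set` D]) (q x * w x)%:E = 0)%E.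
    have finI : (\int[mu]_(x in [set` D]) (q x * w x)%:E)%E \is a fin_num.
      exact: integrable_fin_num intq.
    by rewrite -(fineK finI); congr (_%:E).
  rewrite -[RHS]I0; apply: eq_integral => x _ /=.
  by rewrite ger0_norm // mulr_ge0 // weight_ge0.
move=> aeq0; apply/eqP; apply/negPn/negP => pn0.
have [r pE] := closed_field_poly_normal p.
(* On ]0, pi[ the angle is recovered as the arccosine of the real part, so the angles at which p
   vanishes lie in this finite image of the root list. *)
pose Z : set R := [set acos (complex.Re z) | z in [set` r]].
have Z0 : mu.-negligible Z.
  have fZ : finite_set Z by apply: finite_image; exact: finite_seq.
  have cZ := finite_set_countable fZ.
  apply/negligibleP; last exact: countable_lebesgue_measure0.
  exact: countable_measurable.
have : mu.-negligible (`]0, pi[%classic : set R).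
  apply: negligibleS (negligibleU aeq0 Z0) => x.
  rewrite /= in_itv /= => /andP[x0 xpi].
  have xD : x \in D.
    by rewrite in_itv /= x0 /= (lt_le_trans xpi) // ler_peMl ?pi_ge0 // ler1n.
  have [px0|px0] := eqVneq p.[expi x] 0.
    right; exists (expi x); last by rewrite /= cosK // in_itv /= !ltW.
    have : root p (expi x) by apply/eqP.
    by rewrite pE rootZ ?lead_coef_eq0 // root_prod_XsubC.
  left => /(_ xD) [] /eqP; rewrite mulf_eq0 => /orP[|]; last first.
    apply/negP; rewrite gt_eqF // /weight !mulr_gt0 ?expR_gt0 // powR_gt0 //.
    by rewrite exprn_gt0 // sin_half_gt0.
  rewrite qE paddr_eq0 ?sqr_ge0 // !sqrf_eq0 => /andP[/eqP re0 /eqP im0].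
  by move: px0; rewrite eq_complex re0 im0 !eqxx.
move=> /negligibleP; rewrite /= lebesgue_measure_itv /=.
move=> /(_ (measurable_itv _)) /eqP.
by rewrite lte_fin pi_gt0 oppr0 adde0 eqe gt_eqF ?pi_gt0.
Qed.

(** Each inner product of monomials is a moment depending only on the difference of exponents, and
    the claim becomes the moment identity at exponent k - j. *)
Let opuc_inner_pearson_Xn k j :
  B (('X - 1) * ('X * ('X^k)^`())) 'X^j =
  j%:R * B (('X - 1) * 'X^k) 'X^j - B ('X * 'X^k) 'X^j
  - B (b *: ('X * 'X^k) + Num.conj b *: 'X^k) 'X^j
  - t2 * (B (('X^2 - 'X - 1) * 'X^k) 'X^j + B 'X^k 'X^(j.+1)).
Proof.
have lin := opuc_inner_linear.
have Bl := innerDl _ _ lin; have BN := innerNl _ _ lin.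
have BZ := innerZl _ _ lin.
have -> : 'X * ('X^k)^`() = k%:R *: 'X^k :> {poly R[i]}.
  rewrite derivXn; case: k => [|k]; first by rewrite mulr0n mulr0 scale0r.
  by rewrite mulrnAr -exprS scaler_nat.
rewrite !mulrBl !mul1r -!scalerAr -exprD -!exprS !(Bl, BN, BZ) !opuc_inner_Xn.
have := circle_integral_pearson (k%:R - j%:R).
have -> : k%:R - j%:R + 1 = k.+1%:R - j%:R :> R by rewrite -natr1; ring.
have -> : k%:R - j%:R + 2 = (2 + k)%:R - j%:R :> R by rewrite natrD; ring.
have -> : k%:R - j%:R - 1 = k%:R - j.+1%:R :> R by rewrite -natr1; ring.
rewrite rmorphB !rmorph_nat /=.
set m0 := CI _; set m1 := CI _; set m2 := CI _; set m3 := CI _.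
clearbody m0 m1 m2 m3; move=> pearson; apply/eqP; rewrite -subr_eq0; apply/eqP.
by apply: (etrans _ pearson); ring.
Qed.

Lemma opuc_inner_pearson p j :
  B (('X - 1) * ('X * p^`())) 'X^j =
  j%:R * B (('X - 1) * p) 'X^j - B ('X * p) 'X^j
  - B (b *: ('X * p) + Num.conj b *: p) 'X^j
  - t2 * (B (('X^2 - 'X - 1) * p) 'X^j + B p 'X^(j.+1)).
Proof.
have lin := opuc_inner_linear.
have Bl := innerDl _ _ lin; have BZ := innerZl _ _ lin.
(* The defect of the identity is linear in p, so its vanishing on monomials suffices. *)
pose T p := B (('X - 1) * ('X * p^`())) 'X^j -
  (j%:R * B (('X - 1) * p) 'X^j - B ('X * p) 'X^j
   - B (b *: ('X * p) + Num.conj b *: p) 'X^j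
   - t2 * (B (('X^2 - 'X - 1) * p) 'X^j + B p 'X^(j.+1))).
(* The dummy [q] presents [T] as a form that ignores its second argument, so that the linearity
   lemmas for forms apply to it. *)
have Tlin (q : {poly R[i]}) : linear_for *%R T.
  move=> c p1 p2; rewrite /T derivD derivZ !mulrDr !scalerDr -!scalerAr.
  by rewrite !(Bl, BZ); ring.
have TX i : T 'X^i = 0 by rewrite /T opuc_inner_pearson_Xn subrr.
apply/eqP; rewrite -subr_eq0 -/(T p); apply/eqP; clearbody T.
rewrite -[p]coefK poly_def (inner_suml _ (fun q _ => T q) Tlin _ _ _ 0).
apply: big1 => i _.
by rewrite (innerZl _ (fun q _ => T q) Tlin _ _ 0) TX mulr0.
Qed.

End WeightedCircleIntegral.

(** * Structure relations for the given weight *)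

Theorem theorem4p7 (R : realType) (t eta lambda : R)
    (hlambda : - (1 / 2) < lambda)
    (Phi : nat -> {poly R[i]})
    (hPhi : monic_opuc (weight t eta lambda) Phi)
    (n : nat) (hn : (1 <= n)%N) (z : R[i]) :
  let b : R[i] := lambda +i* eta in
  let alpha := verblunsky Phi in
  let Phis := reversed n (Phi n) in
  z ^+ 2 * (z - 1) * ((Phi n)^`()).[z]
    = U_coef t b alpha n z * (Phi n).[z] + V_coef t b alpha n z * Phis.[z]
  /\
  z * (z - 1) * (Phis^`()).[z]
    = W_coef t b alpha n z * (Phi n).[z] + Y_coef t b alpha n z * Phis.[z].
Proof.
case: hPhi => size_Phi monic_Phi orth_Phi b alpha Phis.
have t2_real : Num.conj (t / 2)%:C = (t / 2)%:C.
  by apply/eqP; rewrite eq_complex /= oppr0 !eqxx.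
pose B p q := opuc_inner (weight t eta lambda) (horner p) (horner q).
have B_linear := opuc_inner_linear R t eta lambda hlambda.
have B_herm := opuc_inner_herm R t eta lambda hlambda.
have B_shift := opuc_inner_shift R t eta lambda.
have B_definite := opuc_inner_definite R t eta lambda hlambda.
have B_pearson := opuc_inner_pearson R t eta lambda hlambda.
(* The weighted inner product satisfies all hypotheses on the abstract form; the polynomial
   identities thus obtained are then evaluated at [z]. *)
have E1 := structure_relation R B B_linear B_herm B_shift B_definite
  b (t / 2)%:C t2_real B_pearson Phi size_Phi monic_Phi orth_Phi n hn.
have E2 := structure_relation_reversed R B B_linear B_herm B_shift B_definite
  b (t / 2)%:C t2_real B_pearson Phi size_Phi monic_Phi orth_Phi n hn.
cbv zeta in E1, E2; split.
- have := congr1 (fun p : {poly R[i]} => p.[z]) E1.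
  rewrite /U_coef /V_coef /s_nn -/alpha -/Phis.
  rewrite !(hornerD, hornerN, hornerZ, hornerM, hornerX) => /eqP.
  rewrite -subr_eq0 => /eqP Ez; apply/eqP; rewrite -subr_eq0; apply/eqP.
  by apply: (etrans _ Ez); ring.
- have := congr1 (fun p : {poly R[i]} => p.[z]) E2.
  rewrite /W_coef /Y_coef /s_nn -/alpha -/Phis.
  rewrite !(hornerD, hornerN, hornerZ, hornerM, hornerX) => /eqP.
  rewrite -subr_eq0 => /eqP Ez; apply/eqP; rewrite -subr_eq0; apply/eqP.
  by apply: (etrans _ Ez); ring.
Qed.
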